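(* Let $(A,d)$ and $(\bar A,\bar d)$ be connected cdga's over $\mathbb{C}$, of finite type in low degrees, and let $\mathfrak{g}$ be a complex Lie algebra. Suppose both $b_1(A)$ and $b_1(\bar{A})$ are positive, and at least one of them is greater than $1$. Then, for any representation $\theta\colon \mathfrak{g}\to \mathfrak{gl}(V)$ in a finite-dimensional non-zero $\mathbb{C}$-vector space $V$, $$\mathcal{R}^1_1(A\vee \bar{A}, \theta) = \mathcal{F}(A\vee \bar{A}, \mathfrak{g}).$$
   Context: A cdga $A=(A^\bullet,d)$ is a graded $\mathbb{C}$-algebra $A=\bigoplus_{i\ge 0}A^i$ (associative, unital, graded-commutative) with a differential $d\colon A^i\to A^{i+1}$, $d^2=0$, satisfying $d(ab)=da\cdot b+(-1)^i a\cdot db$ for $a\in A^i$. It is connected if $A^0=\mathbb{C}$. ''Of finite type in low degrees'' means: there is an integer $k\ge 1$ such that $A^i$ is finite-dimensional for all $i\le k$. We write $b_1(A)=\dim_{\mathbb{C}}H^1(A)$, where $H^\bullet(A)$ is the cohomology of $(A^\bullet,d)$. The wedge sum $A\vee\bar A$ of two connected cdga's is the connected cdga with $(A\vee\bar A)^0=\mathbb{C}$ and $(A\vee\bar A)^i=A^i\oplus\bar A^i$ for $i>0$, with multiplication $(a,\bar a)\cdot(b,\bar b)=(ab,\bar a\bar b)$ in positive degrees and differential $D=d+\bar d$. For a Lie algebra $\mathfrak{g}$, $A\otimes\mathfrak{g}$ is a differential graded Lie algebra with bracket $[a\otimes x,b\otimes y]=ab\otimes[x,y]$ and differential $\partial(a\otimes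 x)=da\otimes x$. The set of flat $\mathfrak{g}$-valued connections is $\mathcal{F}(A,\mathfrak{g})=\{\omega\in A^1\otimes\mathfrak{g}\mid \partial\omega+\tfrac12[\omega,\omega]=0\}$. For $\omega=\sum_j\eta_j\otimes x_j\in\mathcal{F}(A,\mathfrak{g})$, the cochain complex $(A^\bullet\otimes V,d_\omega)$ has differential $d_\omega(\alpha\otimes v)=d\alpha\otimes v+\sum_j\eta_j\alpha\otimes\theta(x_j)(v)$. The resonance varieties are $\mathcal{R}^i_m(A,\theta)=\{\omega\in\mathcal{F}(A,\mathfrak{g})\mid \dim_{\mathbb{C}}H^i(A\otimes V,d_\omega)\ge m\}$. *)

(* Defs.v *)
From HB Require Import structures.
From mathcomp Require Import all_boot all_order all_algebra.
From mathcomp Require Import boolp classical_sets reals complex.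

Set Implicit Arguments.
Unset Strict Implicit.
Unset Printing Implicit Defensive.

Import GRing.Theory.
Local Open Scope classical_set_scope.
Local Open Scope ring_scope.

(* The tensor product over a field of two vector spaces of arbitrary
   dimension.  A finite sequence of pairs (u_k, v_k) stands for the formal sum
   of the u_k ⊗ v_k, and [tens_rel] is the smallest congruence on formal sums
   that makes ⊗ bilinear. *)
Section TensorProduct.
Variables (K : fieldType) (U V : lmodType K).

Inductive tens_rel : seq (U * V) -> seq (U * V) -> Prop :=
| TensRefl s : tens_rel s s
| TensSym s t : tens_rel s t -> tens_rel t s
| TensTrans s t r : tens_rel s t -> tens_rel t r -> tens_rel s r
| TensCat s s' t t' : tens_rel s s' -> tens_rel t t' ->
    tens_rel (s ++ t) (s' ++ t')
| TensComm s t : tens_rel (s ++ t) (t ++ s)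
| TensDl u u' v : tens_rel [:: (u + u', v)] [:: (u, v); (u', v)]
| TensDr u v v' : tens_rel [:: (u, v + v')] [:: (u, v); (u, v')]
| TensZ c u v : tens_rel [:: (c *: u, v)] [:: (u, c *: v)]
| Tens0 v : tens_rel [:: (0, v)] [::].

Definition tens_relb : rel (seq (U * V)) := fun s t => `[< tens_rel s t >].

Lemma tens_relb_refl : reflexive tens_relb.
Proof. by move=> s; apply/asboolP; apply: TensRefl. Qed.

Lemma tens_relb_sym : symmetric tens_relb.
Proof. by move=> s t; apply/asboolP/asboolP; apply: TensSym. Qed.

Lemma tens_relb_trans : transitive tens_relb.
Proof.
by move=> t s r /asboolP st /asboolP tr; apply/asboolP; apply: TensTrans st tr.
Qed.

Canonical tens_equiv :=
  EquivRel tens_relb tens_relb_refl tens_relb_sym tens_relb_trans.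

Definition tens := {eq_quot tens_equiv}%qT.

HB.instance Definition _ := Choice.on tens.
HB.instance Definition _ := EqQuotient.on tens.

Definition tens_class (s : seq (U * V)) : tens := (\pi_tens s)%qT.

Lemma tens_classP s t : tens_rel s t <-> tens_class s = tens_class t.
Proof.
split=> [st|/eqP]; first by apply/eqP; rewrite /tens_class eqmodE; apply/asboolP.
by rewrite /tens_class eqmodE => /asboolP.
Qed.

Lemma tens_repr (t : tens) : tens_class (repr t) = t.
Proof. exact: reprK. Qed.

Lemma tens_classE (P : tens -> Prop) :
  (forall s, P (tens_class s)) -> forall t, P t.
Proof. by move=> H t; rewrite -(tens_repr t). Qed.

Definition tens_add (x y : tens) : tens := tens_class (repr x ++ repr y).
Definition tens_scale (c : K) (x : tens) : tens :=
  tens_class [seq (c *: p.1, p.2) | p <- repr x].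

Lemma tens_rel_repr s : tens_rel (repr (tens_class s)) s.
Proof. by apply/tens_classP; rewrite tens_repr. Qed.

Lemma tens_add_class s t :
  tens_add (tens_class s) (tens_class t) = tens_class (s ++ t).
Proof. by apply/tens_classP/TensCat; apply: tens_rel_repr. Qed.

Lemma tens_rel_scale c s t : tens_rel s t ->
  tens_rel [seq (c *: p.1, p.2) | p <- s] [seq (c *: p.1, p.2) | p <- t].
Proof.
elim=> {s t}.
- by move=> s; apply: TensRefl.
- by move=> s t _ /TensSym.
- by move=> s t r _ st _ /(TensTrans st).
- by move=> s s' t t' _ ss' _ tt'; rewrite !map_cat; apply: TensCat.
- by move=> s t; rewrite !map_cat; apply: TensComm.
- by move=> u u' v /=; rewrite scalerDr; apply: TensDl.
- by move=> u v v'; apply: TensDr.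
- by move=> b u v /=; rewrite scalerA mulrC -scalerA; apply: TensZ.
- by move=> v /=; rewrite scaler0; apply: Tens0.
Qed.

Lemma tens_scale_class c s :
  tens_scale c (tens_class s) = tens_class [seq (c *: p.1, p.2) | p <- s].
Proof. by apply/tens_classP/tens_rel_scale/tens_rel_repr. Qed.

Lemma tens_addA : associative tens_add.
Proof.
elim/tens_classE=> s; elim/tens_classE=> t; elim/tens_classE=> r.
by rewrite !tens_add_class catA.
Qed.

Lemma tens_addC : commutative tens_add.
Proof.
elim/tens_classE=> s; elim/tens_classE=> t.
by rewrite !tens_add_class; apply/tens_classP/TensComm.
Qed.

Lemma tens_add0 : left_id (tens_class [::]) tens_add.
Proof. by elim/tens_classE=> s; rewrite tens_add_class. Qed.

Lemma tens_scaleDl c d x :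
  tens_scale (c + d) x = tens_add (tens_scale c x) (tens_scale d x).
Proof.
elim/tens_classE: x => s; rewrite !tens_scale_class tens_add_class.
apply/tens_classP; elim: s => [|[u v] s IH] /=; first exact: TensRefl.
apply: (TensTrans (t := [:: (c *: u, v); (d *: u, v)]
   ++ ([seq (c *: p.1, p.2) | p <- s] ++ [seq (d *: p.1, p.2) | p <- s]))).
  rewrite -cat1s; apply: TensCat => //.
  by rewrite scalerDl; apply: TensDl.
rewrite -!cat_cons -!(cat1s _ (map _ _)) /= -(cat1s (c *: u, v) (_ :: _)).
rewrite -(cat1s (c *: u, v) (_ ++ _)).
apply: TensCat; first exact: TensRefl.
rewrite -cat_cons -(cat1s _ (map _ _)) -(cat1s (d *: u, v) (map _ _)) !catA.
by apply: TensCat; [exact: TensComm|exact: TensRefl].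
Qed.

Lemma tens_scale0 x : tens_scale 0 x = tens_class [::].
Proof.
elim/tens_classE: x => s; rewrite tens_scale_class; apply/tens_classP.
elim: s => [|[u v] s IH] /=; first exact: TensRefl.
by rewrite scale0r -cat1s -[X in tens_rel _ X]cats0; apply: TensCat (Tens0 v) IH.
Qed.

Lemma tens_scale1 : left_id 1 tens_scale.
Proof.
elim/tens_classE=> s; rewrite tens_scale_class.
by rewrite (eq_map (g := id)) ?map_id // => -[u v] /=; rewrite scale1r.
Qed.

Lemma tens_scaleDr : right_distributive tens_scale tens_add.
Proof.
move=> c; elim/tens_classE=> s; elim/tens_classE=> t.
by rewrite tens_add_class !tens_scale_class tens_add_class map_cat.
Qed.

Lemma tens_scaleA c d x : tens_scale c (tens_scale d x) = tens_scale (c * d) x.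
Proof.
elim/tens_classE: x => s; rewrite !tens_scale_class -map_comp.
by congr tens_class; apply: eq_map => -[u v] /=; rewrite scalerA.
Qed.

Lemma tens_addN : left_inverse (tens_class [::]) (tens_scale (-1)) tens_add.
Proof.
move=> x; rewrite -[X in tens_add _ X]tens_scale1 -tens_scaleDl.
by rewrite addNr tens_scale0.
Qed.

HB.instance Definition _ :=
  GRing.isZmodule.Build tens tens_addA tens_addC tens_add0 tens_addN.

HB.instance Definition _ := GRing.Zmodule_isLmodule.Build K tens
  tens_scaleA tens_scale1 tens_scaleDr
  (fun x c d => tens_scaleDl c d x).

Definition tpure (u : U) (v : V) : tens := tens_class [:: (u, v)].

Lemma tens_classD s t : tens_class s + tens_class t = tens_class (s ++ t).
Proof. exact: tens_add_class. Qed.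

Lemma tens_class_sum s : tens_class s = \sum_(p <- s) tpure p.1 p.2.
Proof.
elim: s => [|[u v] s IH]; first by rewrite big_nil.
by rewrite big_cons -IH /tpure tens_classD.
Qed.

Lemma tensP (t : tens) : exists s : seq (U * V),
  t = \sum_(p <- s) tpure p.1 p.2.
Proof. by exists (repr t); rewrite -tens_class_sum tens_repr. Qed.

Lemma tpure_bilinear : bilinear_for *:%R *:%R tpure.
Proof.
have Zl c u v : c *: tpure u v = tpure (c *: u) v by exact: tens_scale_class.
split=> [v c u u'|u c v v'] /=.
  by rewrite Zl tens_classD; apply/tens_classP; apply: TensDl.
rewrite Zl tens_classD; apply/tens_classP; apply: TensTrans (TensDr _ _ _) _.
apply: (TensCat (s := [:: (u, c *: v)]) (s' := [:: (c *: u, v)]));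
  by [apply/TensSym/TensZ|exact: TensRefl].
Qed.

(* The linear map U ⊗ V -> W, u ⊗ v |-> f u v, induced by a bilinear f
   (and a junk function when f is not bilinear). *)
Definition tlift (W : lmodType K) (f : U -> V -> W) (t : tens) : W :=
  \sum_(p <- repr t) f p.1 p.2.

Section Lift.
Variables (W : lmodType K) (f : U -> V -> W).
Hypothesis bf : bilinear_for *:%R *:%R f.

Lemma tens_rel_lift s t : tens_rel s t ->
  \sum_(p <- s) f p.1 p.2 = \sum_(p <- t) f p.1 p.2.
Proof.
have fD1 u u' v : f (u + u') v = f u v + f u' v.
  by have := bf.1 v 1 u u'; rewrite /= !scale1r.
have fD2 u v v' : f u (v + v') = f u v + f u v'.
  by have := bf.2 u 1 v v'; rewrite /= !scale1r.
have f01 v : f 0 v = 0.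
  by apply: (addrI (f 0 v)); rewrite -fD1 !addr0.
have f02 u : f u 0 = 0.
  by apply: (addrI (f u 0)); rewrite -fD2 !addr0.
elim=> {s t} //.
- by move=> s t r _ -> _ ->.
- by move=> s s' t t' _ IH _ IH'; rewrite !big_cat /= IH IH'.
- by move=> s t; rewrite !big_cat /= addrC.
- by move=> u u' v; rewrite !big_cons !big_nil /= !addr0 fD1.
- by move=> u v v'; rewrite !big_cons !big_nil /= !addr0 fD2.
- move=> c u v; rewrite !big_cons !big_nil /= !addr0.
  have := bf.1 v c u 0; have := bf.2 u c v 0.
  by rewrite /= f01 f02 !addr0 => -> ->.
- by move=> v; rewrite big_cons !big_nil /= f01 addr0.
Qed.

Lemma tlift_class s : tlift f (tens_class s) = \sum_(p <- s) f p.1 p.2.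
Proof. exact/tens_rel_lift/tens_rel_repr. Qed.

Lemma tlift_tpure u v : tlift f (tpure u v) = f u v.
Proof. by rewrite tlift_class big_cons big_nil addr0. Qed.

Lemma tlift_linear : linear (tlift f).
Proof.
move=> c; elim/tens_classE=> s; elim/tens_classE=> t.
have -> : c *: tens_class s = tens_class [seq (c *: p.1, p.2) | p <- s].
  exact: tens_scale_class.
rewrite tens_classD !tlift_class big_cat big_map /= scaler_sumr; congr (_ + _).
apply: eq_bigr => -[u v] _ /=.
have f0 : f 0 v = 0.
  apply: (addrI (f 0 v)).
  by have := bf.1 v 1 0 0; rewrite /= !scale1r !addr0 => <-.
by have := bf.1 v c u 0; rewrite /= f0 !addr0.
Qed.

End Lift.

End TensorProduct.

Arguments tpure {K U V}.
Arguments tlift {K U V W}.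
Notation "u ⊗ v" := (tpure u v) (at level 40, left associativity) : ring_scope.

HB.mixin Record isLieAlgebra (K : fieldType) g of GRing.Lmodule K g := {
  lie : g -> g -> g;
  lie_bilinear : bilinear_for *:%R *:%R lie;
  lie_alternating : forall x, lie x x = 0;
  lie_jacobi : forall x y z,
    lie x (lie y z) + lie y (lie z x) + lie z (lie x y) = 0
}.

#[short(type="lieAlgebraType")]
HB.structure Definition LieAlgebra (K : fieldType) :=
  {g of isLieAlgebra K g & GRing.Lmodule K g}.

Record representation (K : fieldType) (g : lieAlgebraType K) (V : vectType K) :=
  Representation {
    rep_map :> {linear g -> 'End(V)};
    rep_lie : forall x y : g, rep_map (lie x y) =
      (rep_map x \o rep_map y)%VF - (rep_map y \o rep_map x)%VF
  }.

(* The grading is internal: [homog i] is the homogeneous part of degree i, and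
   [homog_span] and [homog_direct] say that A is the direct sum of these parts. *)
HB.mixin Record isCdga (K : fieldType) A of GRing.Algebra K A := {
  homog : nat -> set A;
  homog0 : forall i, homog i 0;
  homogP : forall i (c : K) a b, homog i a -> homog i b -> homog i (c *: a + b);
  homog_span : forall a, exists2 s : seq A,
    {in s, forall b, exists i, homog i b} & a = \sum_(b <- s) b;
  homog_direct : forall n (f : nat -> A), (forall i, homog i (f i)) ->
    \sum_(i < n) f i = 0 -> forall i, (i < n)%N -> f i = 0;
  homog1 : homog 0 1;
  homogM : forall i j a b, homog i a -> homog j b -> homog (i + j)%N (a * b);
  homogC : forall i j a b, homog i a -> homog j b -> a * b = (-1) ^+ (i * j) * (b * a);
  cdiff : A -> A;
  diff_linear : linear cdiff;
  homog_diff : forall i a, homog i a -> homog i.+1 (cdiff a);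
  diffK : forall a, cdiff (cdiff a) = 0;
  diffM : forall i a b, homog i a -> cdiff (a * b) = cdiff a * b + (-1) ^+ i * a * cdiff b
}.

#[short(type="cdgaType")]
HB.structure Definition Cdga (K : fieldType) :=
  {A of isCdga K A & GRing.Algebra K A}.

Arguments homog {K A} : rename.
Arguments cdiff {K A} : rename.
Arguments homogP {K A i c a b} : rename.
Arguments homog1 {K A} : rename.
Arguments homogM {K A i j a b} : rename.
Arguments homogC {K A i j a b} : rename.
Arguments homog_direct {K A n f} : rename.
Arguments homog_diff {K A i a} : rename.
Arguments diffM {K A i a b} : rename.

HB.instance Definition _ (K : fieldType) (A : cdgaType K) :=
  GRing.isLinear.Build K A A *:%R cdiff diff_linear.

(* The unit map K -> A is injective since 1 != 0 in an [algType]. *)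
Definition connected_cdga (K : fieldType) (A : cdgaType K) : Prop :=
  (homog 0 : set A) = range (fun c : K => c%:A).

Definition finite_dim (K : fieldType) (W : lmodType K) (S : set W) : Prop :=
  exists n (e : 'I_n -> W), (forall k, S (e k)) /\
    (forall w, S w -> exists c : 'I_n -> K, w = \sum_k c k *: e k).

Definition finite_type_low (K : fieldType) (A : cdgaType K) : Prop :=
  exists2 k : nat, (1 <= k)%N &
    forall i, (i <= k)%N -> finite_dim (homog i : set A).

(* Cohomology of the complex whose degree i term is [C i], inside an ambient
   space W, with differential D. *)
Section Cohomology.
Variables (K : fieldType) (W : lmodType K) (C : nat -> set W) (D : W -> W).

Definition cocycles (i : nat) : set W := [set w | C i w /\ D w = 0].

Definition coboundaries (i : nat) : set W :=
  if i is j.+1 then D @` C j else [set 0].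

(* dim (cocycles i / coboundaries i) >= m: there are m cocycles which are
   linearly independent modulo coboundaries.  The quotient may be
   infinite-dimensional. *)
Definition dim_cohomology_ge (i m : nat) : Prop :=
  exists w : 'I_m -> W, (forall k, cocycles i (w k)) /\
    (forall c : 'I_m -> K, coboundaries i (\sum_k c k *: w k) ->
      forall k, c k = 0).

End Cohomology.

Definition betti_ge (K : fieldType) (A : cdgaType K) (i m : nat) : Prop :=
  dim_cohomology_ge (homog : nat -> set A) cdiff i m.

Section Connections.
Variables (K : fieldType) (A : cdgaType K).

(* A^i ⊗ W, as a subspace of A ⊗ W. *)
Definition thom (W : lmodType K) (i : nat) : set (tens A W) :=
  [set t | exists2 s : seq (A * W), {in s, forall p, homog i p.1} &
    t = \sum_(p <- s) p.1 ⊗ p.2].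

Definition tdiff (W : lmodType K) : tens A W -> tens A W :=
  tlift (fun a w => cdiff a ⊗ w).

(* (a ⊗ x) (b ⊗ y) = ab ⊗ beta x y. *)
Definition tmul (W1 W2 W3 : lmodType K) (beta : W1 -> W2 -> W3)
    (s : tens A W1) (t : tens A W2) : tens A W3 :=
  tlift (fun a x => tlift (fun b y => (a * b) ⊗ beta x y) t) s.

Lemma tdiff_bilinear (W : lmodType K) : bilinear_for *:%R *:%R
  (fun (a : A) (w : W) => cdiff a ⊗ w).
Proof.
have [bl br] := @tpure_bilinear K A W.
split=> [w c a a'|a c w w'] /=; first by rewrite linearP; apply: bl.
exact: br.
Qed.

Lemma tdiff_tpure (W : lmodType K) (a : A) (w : W) :
  tdiff (a ⊗ w) = cdiff a ⊗ w.
Proof. exact/tlift_tpure/tdiff_bilinear. Qed.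

Lemma tdiff_linear (W : lmodType K) : linear (@tdiff W).
Proof. exact/tlift_linear/tdiff_bilinear. Qed.

Section Mul.
Variables (W1 W2 W3 : lmodType K) (beta : W1 -> W2 -> W3).
Hypothesis bbeta : bilinear_for *:%R *:%R beta.

Lemma tmul_bilinear_r (a : A) (x : W1) : bilinear_for *:%R *:%R
  (fun (b : A) (y : W2) => (a * b) ⊗ beta x y).
Proof.
have [bl br] := @tpure_bilinear K A W3.
split=> [y c b b'|b c y y'] /=.
  by rewrite mulrDr -scalerAr; apply: bl.
by rewrite (bbeta.2 x); apply: br.
Qed.

Lemma tmul_bilinear_l (t : tens A W2) : bilinear_for *:%R *:%R
  (fun (a : A) (x : W1) => tlift (fun b y => (a * b) ⊗ beta x y) t).
Proof.
have [bl br] := @tpure_bilinear K A W3.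
split=> [x c a a'|a c x x'] /=; rewrite /tlift scaler_sumr -big_split /=;
  apply: eq_bigr => p _.
  by rewrite mulrDl -scalerAl; apply: bl.
by rewrite (bbeta.1 p.2); apply: br.
Qed.

Lemma tmul_bilinear : bilinear_for *:%R *:%R (tmul beta).
Proof.
split=> [t|s]; first exact/tlift_linear/tmul_bilinear_l.
move=> c t t' /=; rewrite /tmul /tlift scaler_sumr -big_split /=.
apply: eq_bigr => p _; exact: (tlift_linear (tmul_bilinear_r p.1 p.2)).
Qed.

Lemma tmul_tpure (a b : A) (x : W1) (y : W2) :
  tmul beta (a ⊗ x) (b ⊗ y) = (a * b) ⊗ beta x y.
Proof.
rewrite /tmul tlift_tpure; last exact: tmul_bilinear_l.
exact/tlift_tpure/tmul_bilinear_r.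
Qed.

End Mul.

Variable g : lieAlgebraType K.

Definition flat : set (tens A g) :=
  [set w | thom 1 w /\ tdiff w + 2%:R^-1 *: tmul lie w w = 0].

Variables (V : vectType K) (theta : representation g V).

Definition tcov (w : tens A g) (t : tens A V) : tens A V :=
  tdiff t + tmul (fun x v => theta x v) w t.

Lemma rep_bilinear : bilinear_for *:%R *:%R (fun (x : g) (v : V) => theta x v).
Proof.
split=> [v c x y|x c v v'] /=; last exact: linearP.
by rewrite linearP !lfunE /= !lfunE.
Qed.

Lemma tcov_tpure (s : seq (A * g)) (a : A) (v : V) :
  tcov (\sum_(p <- s) p.1 ⊗ p.2) (a ⊗ v) =
    cdiff a ⊗ v + \sum_(p <- s) (p.1 * a) ⊗ theta p.2 v.
Proof.
rewrite /tcov tdiff_tpure -tens_class_sum /tmul; congr (_ + _).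
rewrite tlift_class; last exact: (tmul_bilinear_l rep_bilinear).
by apply: eq_bigr => p _; apply/tlift_tpure/(tmul_bilinear_r rep_bilinear).
Qed.

Definition resonance (i m : nat) : set (tens A g) :=
  [set w | flat w /\ dim_cohomology_ge (@thom V) (tcov w) i m].

End Connections.

Arguments flat {K} A g.
Arguments resonance {K} A {g V} theta i m.

Section Wedge.
Variables (K : fieldType).

(* The sum of the [homog i] over i > 0. *)
Definition posdeg (A : cdgaType K) : set A :=
  [set a | exists2 s : seq A, {in s, forall b, exists i, homog i.+1 b} &
    a = \sum_(b <- s) b].

Section Posdeg.
Variable A : cdgaType K.

Lemma posdeg0 : posdeg (0 : A).
Proof. by exists [::] => //; rewrite big_nil. Qed.

Lemma posdegD (a b : A) : posdeg a -> posdeg b -> posdeg (a + b).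
Proof.
move=> [s Hs ->] [t Ht ->]; exists (s ++ t); last by rewrite big_cat.
by move=> x; rewrite mem_cat => /orP[/Hs|/Ht].
Qed.

Lemma homogZ (i : nat) (c : K) (a : A) : homog i a -> homog i (c *: a).
Proof. by move=> Ha; rewrite -[_ *: _]addr0; apply: homogP => //; apply: homog0. Qed.

Lemma posdegZ (c : K) (a : A) : posdeg a -> posdeg (c *: a).
Proof.
move=> [s Hs ->]; exists [seq c *: b | b <- s].
  by move=> x /mapP[b /Hs[i Hi] ->]; exists i; apply: homogZ.
by rewrite big_map scaler_sumr.
Qed.

Lemma posdeg_homog (i : nat) (a : A) : homog i.+1 a -> posdeg a.
Proof.
move=> Ha; exists [:: a]; last by rewrite big_cons big_nil addr0.
by move=> x; rewrite inE => /eqP ->; exists i.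
Qed.

Lemma posdeg_sum (I : eqType) (s : seq I) (F : I -> A) :
  {in s, forall b, posdeg (F b)} -> posdeg (\sum_(b <- s) F b).
Proof.
elim: s => [|b s IH] H; first by rewrite big_nil; apply: posdeg0.
rewrite big_cons; apply: posdegD; first by apply: H; rewrite mem_head.
by apply: IH => x xs; apply: H; rewrite inE xs orbT.
Qed.

Lemma posdegM (a b : A) : posdeg a -> posdeg b -> posdeg (a * b).
Proof.
move=> [s Hs ->] [t Ht ->]; rewrite mulr_suml; apply: posdeg_sum => x xs.
rewrite mulr_sumr; apply: posdeg_sum => y yt.
have [i Hi] := Hs x xs; have [j Hj] := Ht y yt.
by apply: (@posdeg_homog (i + j.+1)); rewrite -addSn; apply: homogM.
Qed.

Lemma posdeg_diff (a : A) : posdeg (cdiff a).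
Proof.
have [s Hs ->] := homog_span a; rewrite linear_sum /=; apply: posdeg_sum => x xs.
by have [i Hi] := Hs x xs; apply: (@posdeg_homog i); apply: homog_diff.
Qed.

Lemma diff1 : cdiff (1 : A) = 0.
Proof.
have := diffM (b := 1) (homog1 (A := A)); rewrite expr0 !mul1r mulr1 => H.
by apply: (addrI (cdiff 1)); rewrite -H addr0.
Qed.

End Posdeg.

Variables A B : cdgaType K.

(* The wedge sum K + A^{>0} + B^{>0}, realized as the subalgebra of A x B of
   the pairs whose two components have the same scalar part. *)
Definition wedge_pred : {pred A * B} := fun x =>
  `[< exists (c : K) (a : A) (b : B),
      [/\ posdeg a, posdeg b & x = (c%:A + a, c%:A + b)] >].

Lemma wedge_closed : GRing.subsemialg_closed wedge_pred.
Proof.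
apply: GRing.subalg_closed_semi; split.
- apply/asboolP; exists 1, 0, 0; split; [exact: posdeg0|exact: posdeg0|].
  by rewrite !addr0 !scale1r.
- move=> k x y /asboolP[c [a [b [Ha Hb ->]]]] /asboolP[d [a' [b' [Ha' Hb' ->]]]].
  apply/asboolP; exists (k * c + d), (k *: a + a'), (k *: b + b').
  split; [by apply/posdegD/Ha'/posdegZ|by apply/posdegD/Hb'/posdegZ|].
  by congr (_, _); rewrite /= scalerDr scalerDl scalerA addrACA.
- move=> x y /asboolP[c [a [b [Ha Hb ->]]]] /asboolP[d [a' [b' [Ha' Hb' ->]]]].
  apply/asboolP; exists (c * d), (c *: a' + (d *: a + a * a')),
    (c *: b' + (d *: b + b * b')).
  split; [by apply/posdegD/posdegD/posdegM => //; apply: posdegZ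
         |by apply/posdegD/posdegD/posdegM => //; apply: posdegZ|].
  by congr (_, _);
    rewrite /= mulrDl !mulrDr -!scalerAl -!scalerAr !mul1r mulr1 scalerA -addrA.
Qed.

HB.instance Definition _ :=
  GRing.isSubalgClosed.Build K (A * B)%type wedge_pred wedge_closed.

Record wedge := Wedge { wval : A * B; _ : wval \in wedge_pred }.

HB.instance Definition _ := [isSub for wval].
HB.instance Definition _ := [Choice of wedge by <:].
HB.instance Definition _ := [SubChoice_isSubAlgebra of wedge by <:].

Definition wedge_homog (i : nat) : set wedge :=
  if i is 0 then range (fun c : K => c%:A)
  else [set w | homog i (wval w).1 /\ homog i (wval w).2].

Lemma wedge_diff_subproof (w : wedge) :
  (cdiff (wval w).1, cdiff (wval w).2) \in wedge_pred.
Proof.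
apply/asboolP; exists 0, (cdiff (wval w).1), (cdiff (wval w).2).
by split; [exact: posdeg_diff|exact: posdeg_diff|rewrite !scale0r !add0r].
Qed.

Definition wedge_diff (w : wedge) : wedge := Wedge (wedge_diff_subproof w).

Fact wedge_homog0 i : wedge_homog i 0.
Proof.
case: i => [|i]; first by exists 0 => //; rewrite scale0r.
by split; apply: homog0.
Qed.

Fact wedge_homogP i (c : K) (a b : wedge) :
  wedge_homog i a -> wedge_homog i b -> wedge_homog i (c *: a + b).
Proof.
case: i => [[x _ <-] [y _ <-]|i [Ha Hb] [Ha' Hb']].
  by exists (c * x + y) => //; rewrite scalerDl scalerA.
by split; apply: homogP.
Qed.

Fact wedge_homog_fst i (w : wedge) : wedge_homog i w -> homog i (wval w).1.
Proof.
case: i => [[c _ <-]|i []//]; exact: (homogZ c (homog1 (A := A))).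
Qed.

Fact wedge_homog_snd i (w : wedge) : wedge_homog i w -> homog i (wval w).2.
Proof.
case: i => [[c _ <-]|i []//]; exact: (homogZ c (homog1 (A := B))).
Qed.

Fact wedge_inl_subproof (a : A) : posdeg a -> (a, 0) \in wedge_pred.
Proof.
move=> Ha; apply/asboolP; exists 0, a, 0; split=> //; first exact: posdeg0.
by rewrite !scale0r !add0r.
Qed.

Fact wedge_inr_subproof (b : B) : posdeg b -> (0, b) \in wedge_pred.
Proof.
move=> Hb; apply/asboolP; exists 0, 0, b; split=> //; first exact: posdeg0.
by rewrite !scale0r !add0r.
Qed.

Fact wedge_homog_span (w : wedge) : exists2 s : seq wedge,
  {in s, forall b, exists i, wedge_homog i b} & w = \sum_(b <- s) b.
Proof.
pose P w := exists2 s : seq wedge,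
  {in s, forall b, exists i, wedge_homog i b} & w = \sum_(b <- s) b.
have PD x y : P x -> P y -> P (x + y).
  move=> [s Hs ->] [t Ht ->]; exists (s ++ t); last by rewrite big_cat.
  by move=> z; rewrite mem_cat => /orP[/Hs|/Ht].
have P1 i x : wedge_homog i x -> P x.
  move=> Hx; exists [:: x]; last by rewrite big_cons big_nil addr0.
  by move=> z; rewrite inE => /eqP ->; exists i.
have Pl a (Ha : posdeg a) (x : wedge) : wval x = (a, 0) -> P x.
  case: Ha => s; elim: s a x => [|b s IH] a x Hs ->; rewrite ?(big_nil, big_cons).
    move=> Hx; apply: (P1 0%N); rewrite (_ : x = 0); first exact: wedge_homog0.
    exact: val_inj.
  have [i Hi] := Hs b (mem_head _ _).
  have Hs' : {in s, forall b, exists i, homog i.+1 b}.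
    by move=> z zs; apply: Hs; rewrite inE zs orbT.
  have Pb := posdeg_homog Hi.
  have Pr : posdeg (\sum_(b <- s) b) by exists s.
  move=> Hx; rewrite (_ : x = Wedge (wedge_inl_subproof Pb)
                           + Wedge (wedge_inl_subproof Pr)).
    apply: PD; last exact: (IH _ _ Hs' erefl).
    by apply: (P1 i.+1); split=> //=; apply: homog0.
  by apply: val_inj => /=; rewrite Hx; congr (_, _); rewrite /= addr0.
have Pr b (Hb : posdeg b) (x : wedge) : wval x = (0, b) -> P x.
  case: Hb => s; elim: s b x => [|a s IH] b x Hs ->; rewrite ?(big_nil, big_cons).
    move=> Hx; apply: (P1 0%N); rewrite (_ : x = 0); first exact: wedge_homog0.
    exact: val_inj.
  have [i Hi] := Hs a (mem_head _ _).
  have Hs' : {in s, forall b, exists i, homog i.+1 b}.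
    by move=> z zs; apply: Hs; rewrite inE zs orbT.
  have Pb := posdeg_homog Hi.
  have Pr : posdeg (\sum_(b <- s) b) by exists s.
  move=> Hx; rewrite (_ : x = Wedge (wedge_inr_subproof Pb)
                           + Wedge (wedge_inr_subproof Pr)).
    apply: PD; last exact: (IH _ _ Hs' erefl).
    by apply: (P1 i.+1); split=> //=; apply: homog0.
  by apply: val_inj => /=; rewrite Hx; congr (_, _); rewrite /= addr0.
have /asboolP[c [a [b [Ha Hb Hw]]]] := valP w.
rewrite -/(P w) (_ : w = c%:A + (Wedge (wedge_inl_subproof Ha)
                      + Wedge (wedge_inr_subproof Hb))).
  have Pc : P c%:A by apply: (P1 0%N); exists c.
  exact: PD Pc (PD _ _ (Pl _ Ha (Wedge _) erefl) (Pr _ Hb (Wedge _) erefl)).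
by apply: val_inj; rewrite Hw; congr (_, _); rewrite /= ?addr0 ?add0r.
Qed.

Fact wedge_homog_direct n (f : nat -> wedge) : (forall i, wedge_homog i (f i)) ->
  \sum_(i < n) f i = 0 -> forall i, (i < n)%N -> f i = 0.
Proof.
move=> Hf f0 i i_n.
have f1 : \sum_(i < n) (wval (f i)).1 = 0.
  by rewrite -[RHS]/((\val (0 : wedge)).1) -f0 !raddf_sum.
have f2 : \sum_(i < n) (wval (f i)).2 = 0.
  by rewrite -[RHS]/((\val (0 : wedge)).2) -f0 !raddf_sum.
have e1 := homog_direct (fun i => wedge_homog_fst (Hf i)) f1 i i_n.
have e2 := homog_direct (fun i => wedge_homog_snd (Hf i)) f2 i i_n.
by apply: val_inj; rewrite [LHS]surjective_pairing e1 e2.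
Qed.

Fact wedge_homog1 : wedge_homog 0 1.
Proof. by exists 1 => //; rewrite scale1r. Qed.

Fact wedge_homogM i j (a b : wedge) :
  wedge_homog i a -> wedge_homog j b -> wedge_homog (i + j)%N (a * b).
Proof.
case: i => [[c _ <-] Hb|i Ha Hb].
  rewrite add0n -scalerAl mul1r -[_ *: _]addr0; apply: wedge_homogP => //.
  exact: wedge_homog0.
split; apply: (homogM (i := i.+1)).
- exact: (wedge_homog_fst (i := i.+1)).
- exact: wedge_homog_fst.
- exact: (wedge_homog_snd (i := i.+1)).
- exact: wedge_homog_snd.
Qed.

Fact wedge_homogC i j (a b : wedge) : wedge_homog i a -> wedge_homog j b ->
  a * b = (-1) ^+ (i * j) * (b * a).
Proof.
move=> Ha Hb; apply: val_inj; rewrite 2!rmorphM rmorphXn rmorphN1 rmorphM /=.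
rewrite [LHS]surjective_pairing [RHS]surjective_pairing /=; congr (_, _).
  rewrite (homogC (wedge_homog_fst Ha) (wedge_homog_fst Hb)).
  by rewrite (rmorphXn fst).
rewrite (homogC (wedge_homog_snd Ha) (wedge_homog_snd Hb)).
by rewrite (rmorphXn snd).
Qed.

Fact wedge_diff_linear : linear wedge_diff.
Proof. by move=> c x y; apply: val_inj; congr (_, _); rewrite /= linearP. Qed.

Fact wedge_homog_diff i (a : wedge) : wedge_homog i a -> wedge_homog i.+1 (wedge_diff a).
Proof.
move=> Ha; split; apply: homog_diff; [exact: wedge_homog_fst|exact: wedge_homog_snd].
Qed.

Fact wedge_diffK a : wedge_diff (wedge_diff a) = 0.
Proof. by apply: val_inj; congr (_, _); rewrite /= diffK. Qed.

Fact wedge_diffM i (a b : wedge) : wedge_homog i a ->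
  wedge_diff (a * b) = wedge_diff a * b + (-1) ^+ i * a * wedge_diff b.
Proof.
move=> Ha; apply: val_inj; rewrite rmorphD !rmorphM rmorphXn rmorphN1 /=.
rewrite [RHS]surjective_pairing; congr (_, _) => /=.
  by rewrite (diffM (wedge_homog_fst Ha)) (rmorphXn fst).
by rewrite (diffM (wedge_homog_snd Ha)) (rmorphXn snd).
Qed.

HB.instance Definition _ := isCdga.Build K wedge
  wedge_homog0 wedge_homogP wedge_homog_span wedge_homog_direct wedge_homog1
  wedge_homogM wedge_homogC wedge_diff_linear wedge_homog_diff wedge_diffK
  wedge_diffM.

Lemma wedge_connected : connected_cdga wedge.
Proof. by []. Qed.

End Wedge.

(* Main.v *)
Require Import Defs.
From HB Require Import structures.
From mathcomp Require Import all_boot all_order all_algebra.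
From mathcomp Require Import boolp classical_sets reals complex.
Import GRing.Theory.
Local Open Scope classical_set_scope.
Local Open Scope ring_scope.

(** Write W for the wedge sum.  Its degree 1 part is the direct sum of those of
    A and B, and the two parts annihilate each other, because the elements with
    zero B-component and those with zero A-component form differential ideals P
    and Q that meet in 0 ([left_part], [right_part]).  Everything takes place
    for an arbitrary connected cdga W with such a pair of ideals
    ([resonance_of_disjoint_ideals]).

    Let w be a flat connection, split as wP + wQ.  Let KP and KQ be the spaces
    of the v in V with wP (1 ⊗ v) = 0 and with wQ (1 ⊗ v) = 0.  There are enough
    explicit 1-cocycles:
    - wP (1 ⊗ v) for every v: this is the P-component of the coboundary
      of 1 ⊗ v, and the covariant derivative respects the two components
      ([split_half_closed]);
    - a ⊗ v for a closed a of degree 1 in P and v in KP: wP kills it because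
      wP (a ⊗ v) = (wP (1 ⊗ v)) a, and wQ kills it because Q P lies in
      P ∩ Q = 0 ([split_tpure_closed]);
    and symmetrically for Q.

    Suppose that every 1-cocycle were a coboundary.  As W is connected, the
    coboundaries are the elements wP (1 ⊗ u) + wQ (1 ⊗ u), so a cocycle with
    zero Q-component is wP (1 ⊗ u) for some u in KQ ([split_half_exact]).
    Cocycles of the first kind then give V = KP + KQ.  If P has m independent
    closed elements of degree 1, those of the second kind give
    m * dim KP <= dim KQ ([dim_lift_le]), and similarly n * dim KQ <= dim KP.
    When m * n > 1 this forces KP = KQ = 0, hence V = 0, a contradiction.  The
    positivity of both first Betti numbers, with one of them greater than 1,
    lets (m, n) be (2, 1) or (1, 2).

    As W may be infinite-dimensional, a tensor t in W ⊗ V is studied through its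
    contractions with the linear functionals of V, which lie in W and vanish
    simultaneously only for t = 0 ([contract_eq0]). *)

Set Implicit Arguments.
Unset Strict Implicit.
Unset Printing Implicit Defensive.

(** * Subspaces of a finite-dimensional space *)

Section Dimension.
Variables (K : fieldType) (V : vectType K).

Lemma dim_ge_card (T : finType) (u : T -> V) (U : {vspace V}) :
  (forall t, u t \in U) ->
  (forall c : T -> K, \sum_t c t *: u t = 0 -> forall t, c t = 0) ->
  (#|T| <= \dim U)%N.
Proof.
move=> uU u_free; pose X := [tuple u (enum_val i) | i < #|T|].
have /eqP dimX : free X.
  apply/freeP => k kX0 i; rewrite -(enum_valK i).
  apply: (u_free (k \o enum_rank)).
  rewrite (reindex (@enum_val T T)) /=; last first.
    by apply: onW_bij; exists enum_rank; [exact: enum_valK|exact: enum_rankK].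
  rewrite -[RHS]kX0; apply: eq_bigr => j _.
  by rewrite enum_valK (nth_map j) ?size_enum_ord // nth_ord_enum.
have : (<<X>> <= U)%VS.
  by apply/span_subvP => _ /mapP[i _ ->].
by move/dimvS; rewrite dimX size_tuple.
Qed.

(** The codomain may be infinite-dimensional, so the kernel is obtained as a
    subspace of maximal dimension on which f vanishes. *)
Lemma linear_kernel (T : lmodType K) (f : {linear V -> T}) :
  exists U : {vspace V}, forall v, v \in U <-> f v = 0.
Proof.
pose P n := `[< exists2 U : {vspace V}, \dim U = n & forall v, v \in U -> f v = 0 >].
have exP : exists n, P n.
  exists 0%N; apply/asboolP; exists 0%VS; rewrite ?dimv0 // => v.
  by rewrite memv0 => /eqP ->; rewrite linear0.
have P_le n : P n -> (n <= \dim {:V})%N.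
  by move=> /asboolP[U <- _]; apply/dimvS/subvf.
case: (ex_maxnP exP P_le) => _ /asboolP[U <- U0] U_max.
exists U => v; split=> [/U0//|v0].
have : (\dim (U + <[v]>)%VS <= \dim U)%N.
  apply: U_max; apply/asboolP; exists (U + <[v]>)%VS => // x.
  case/memv_addP=> y yU [_ /vlineP[c ->] ->].
  by rewrite linearD linearZ /= v0 scaler0 addr0 U0.
rewrite (geq_leqif (dimv_leqif_sup (addvSl U <[v]>%VS))) subv_add.
by rewrite -memvE => /andP[].
Qed.

End Dimension.

(** * Tensor calculus *)

Section Bilinear.
Variables (K : fieldType) (U1 U2 U3 : lmodType K) (f : U1 -> U2 -> U3).
Hypothesis f_bilinear : bilinear_for *:%R *:%R f.

Lemma bilinDl u u' v : f (u + u') v = f u v + f u' v.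
Proof. by have := f_bilinear.1 v 1 u u'; rewrite /= !scale1r. Qed.

Lemma bilinDr u v v' : f u (v + v') = f u v + f u v'.
Proof. by have := f_bilinear.2 u 1 v v'; rewrite /= !scale1r. Qed.

Lemma bilin0l v : f 0 v = 0.
Proof. by apply: (addrI (f 0 v)); rewrite -bilinDl !addr0. Qed.

Lemma bilin0r u : f u 0 = 0.
Proof. by apply: (addrI (f u 0)); rewrite -bilinDr !addr0. Qed.

Lemma bilinZl c u v : f (c *: u) v = c *: f u v.
Proof. by have := f_bilinear.1 v c u 0; rewrite /= bilin0l !addr0. Qed.

End Bilinear.

Section TensorCalculus.
Variables (K : fieldType) (U V : lmodType K).

Lemma tens_ind (P : tens U V -> Prop) : P 0 ->
  (forall u v t, P t -> P (u ⊗ v + t)) -> forall t, P t.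
Proof.
move=> P0 PD t; have [s ->] := tensP t.
elim: s => [|p s IH]; first by rewrite big_nil.
by rewrite big_cons; apply: PD.
Qed.

Lemma tpureDl (u u' : U) (v : V) : (u + u') ⊗ v = u ⊗ v + u' ⊗ v.
Proof. exact: bilinDl (@tpure_bilinear K U V) _ _ _. Qed.

Lemma tpure0l (v : V) : (0 : U) ⊗ v = 0.
Proof. exact: bilin0l (@tpure_bilinear K U V) _. Qed.

Lemma tpureZl c (u : U) (v : V) : (c *: u) ⊗ v = c *: (u ⊗ v).
Proof. exact: bilinZl (@tpure_bilinear K U V) _ _ _. Qed.

HB.instance Definition _ (u : U) :=
  GRing.isLinear.Build K _ _ *:%R (tpure u : V -> tens U V)
    ((@tpure_bilinear K U V).2 u).

Lemma tpureZr c (u : U) (v : V) : u ⊗ (c *: v) = c *: (u ⊗ v).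
Proof. exact: linearZ. Qed.

End TensorCalculus.

Section Contraction.
Variables (K : fieldType) (W : cdgaType K) (V : vectType K).
Implicit Types (f : {linear V -> K^o}) (t : tens W V).

Definition contract f : tens W V -> W := tlift (fun w v => (f v : K) *: w).

Lemma contract_bilinear f :
  bilinear_for *:%R *:%R (fun (w : W) (v : V) => (f v : K) *: w).
Proof.
split=> [v c w w'|w c v v'] /=.
  by rewrite scalerDr !scalerA mulrC.
by rewrite linearP /= scalerDl scalerA.
Qed.

HB.instance Definition _ f := GRing.isLinear.Build K _ _ *:%R (contract f)
  (tlift_linear (contract_bilinear f)).

Lemma contract_tpure f w v : contract f (w ⊗ v) = (f v : K) *: w.
Proof. exact/tlift_tpure/contract_bilinear. Qed.

HB.instance Definition _ (U : lmodType K) := GRing.isLinear.Build K _ _ *:%R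
  (@tdiff K W U) (@tdiff_linear K W U).

(** The contractions with the coordinates in a basis e of V are the coefficients
    of t in the decomposition of W ⊗ V as the sum of the W ⊗ e_i. *)
Lemma contract_eq0 t : (forall f, contract f t = 0) -> t = 0.
Proof.
pose e := vbasis {:V}.
have tE : t = \sum_i contract (coord e i) t ⊗ e`_i.
  elim/tens_ind: t => [|w v t IH].
    by rewrite big1 // => i _; rewrite linear0 tpure0l.
  under [RHS]eq_bigr => i _ do
    rewrite linearD /= contract_tpure tpureDl tpureZl -tpureZr.
  rewrite big_split /= -IH -linear_sum /=.
  by rewrite -(coord_vbasis (memvf v)).
by move=> t0; rewrite tE big1 // => i _; rewrite t0 tpure0l.
Qed.

End Contraction.

Lemma thom_ind (K : fieldType) (W : cdgaType K) (U : lmodType K) i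
    (P : tens W U -> Prop) : P 0 ->
  (forall a u t, homog i a -> P t -> P (a ⊗ u + t)) ->
  forall t, thom i t -> P t.
Proof.
move=> P0 PD _ [s s_i ->]; elim: s s_i => [|p s IH] s_i.
  by rewrite big_nil.
rewrite big_cons; apply: PD; first by apply: s_i; rewrite mem_head.
by apply: IH => q qs; apply: s_i; rewrite inE qs orbT.
Qed.

(** * The covariant derivative *)

Section Covariant.
Variables (K : fieldType) (W : cdgaType K) (V : vectType K).
Variables (g : lieAlgebraType K) (theta : representation g V).
Implicit Types (f : {linear V -> K^o}) (w : tens W g) (t : tens W V).

Definition act w t : tens W V := tmul (fun x v => theta x v) w t.

Lemma act_tpure a x b v : act (a ⊗ x) (b ⊗ v) = (a * b) ⊗ theta x v.
Proof. exact/tmul_tpure/rep_bilinear. Qed.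

Lemma act_bilinear : bilinear_for *:%R *:%R act.
Proof. exact: tmul_bilinear (rep_bilinear theta). Qed.

HB.instance Definition _ w :=
  GRing.isLinear.Build K _ _ *:%R (act w) (act_bilinear.2 w).

Lemma actDl w w' t : act (w + w') t = act w t + act w' t.
Proof. exact: bilinDl act_bilinear _ _ _. Qed.

Lemma act0l t : act 0 t = 0.
Proof. exact: bilin0l act_bilinear _. Qed.

(** Contracting after x acts on V amounts to contracting with another functional,
    so one-sided multiplications of W pass through all contractions at once. *)
Lemma contract_act_tpure f a x t :
  contract f (act (a ⊗ x) t) = a * contract (f \o theta x) t.
Proof.
elim/tens_ind: t => [|b v t IH]; first by rewrite !linear0 mulr0.
rewrite !linearD /= IH act_tpure !contract_tpure mulrDr.
by rewrite -scalerAr.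
Qed.

Lemma contract_act_unit f w a v :
  contract f (act w (a ⊗ v)) = contract f (act w (1 ⊗ v)) * a.
Proof.
elim/tens_ind: w => [|b x w IH]; first by rewrite !act0l linear0 mul0r.
rewrite !actDl !linearD /= IH !act_tpure !contract_tpure mulrDl.
by rewrite mulr1 scalerAl.
Qed.

Lemma contract_tdiff f t : contract f (tdiff t) = cdiff (contract f t).
Proof.
elim/tens_ind: t => [|a v t IH]; first by rewrite !linear0.
by rewrite !linearD /= IH tdiff_tpure !contract_tpure linearZ.
Qed.

(** Evaluation at a fixed vector v of the g-factor.  It carries the
    Maurer-Cartan equation from W ⊗ g to W ⊗ V, where it becomes the vanishing
    of the square of the covariant derivative at 1 ⊗ v. *)
Definition rep_ev (v : V) : tens W g -> tens W V :=
  tlift (fun a x => a ⊗ theta x v).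

Lemma rep_ev_bilinear v :
  bilinear_for *:%R *:%R (fun (a : W) (x : g) => a ⊗ theta x v).
Proof.
split=> [x c a a'|a c x x'] /=; first by rewrite tpureDl tpureZl.
by rewrite (rep_bilinear theta).1 linearP.
Qed.

HB.instance Definition _ v := GRing.isLinear.Build K _ _ *:%R (rep_ev v)
  (tlift_linear (rep_ev_bilinear v)).

Lemma rep_ev_tpure v a x : rep_ev v (a ⊗ x) = a ⊗ theta x v.
Proof. exact/tlift_tpure/rep_ev_bilinear. Qed.

Lemma rep_evE v w : rep_ev v w = act w (1 ⊗ v).
Proof.
elim/tens_ind: w => [|a x w IH]; first by rewrite linear0 act0l.
by rewrite linearD /= actDl IH rep_ev_tpure act_tpure mulr1.
Qed.

Lemma tdiff_rep_ev v w : tdiff (rep_ev v w) = rep_ev v (tdiff w).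
Proof.
elim/tens_ind: w => [|a x w IH]; first by rewrite !linear0.
by rewrite !linearD /= IH !(rep_ev_tpure, tdiff_tpure).
Qed.

(** The commutator in the representation of [x, y] has two terms; the sign of the
    second one is absorbed by a b = - b a in degree 1.  The polarized form is
    bilinear in (w, w'), which reduces the proof to pure tensors. *)
Lemma rep_ev_lie v w w' : thom 1 w -> thom 1 w' ->
  rep_ev v (tmul lie w w') = act w (rep_ev v w') + act w' (rep_ev v w).
Proof.
have lie_b := @tmul_bilinear K W _ _ _ _ (@lie_bilinear K g).
move=> Hw Hw'; move: w Hw; apply: thom_ind => [|a x t a1 IH].
  by rewrite (bilin0l lie_b) !linear0 act0l addr0.
rewrite (bilinDl lie_b) !linearD /= IH actDl addrACA; congr (_ + _).
move: w' Hw' {IH}; apply: thom_ind => [|b y u b1 IH].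
  by rewrite (bilin0r lie_b) !linear0 act0l addr0.
rewrite (bilinDr lie_b) !linearD /= IH actDl addrACA; congr (_ + _).
rewrite (tmul_tpure (@lie_bilinear K g)) !rep_ev_tpure !act_tpure.
rewrite (homogC b1 a1) expr1 mulN1r -scaleN1r tpureZl scaleN1r -linearN.
by rewrite -linearD rep_lie /= !lfun_simp.
Qed.

Hypothesis two_neq0 : 2%:R != 0 :> K.

Lemma tcov_square0 v w : flat W g w -> tcov theta w (tcov theta w (1 ⊗ v)) = 0.
Proof.
case=> w1 w_flat.
have -> : tcov theta w (1 ⊗ v) = rep_ev v w.
  by rewrite /tcov tdiff_tpure diff1 tpure0l add0r rep_evE.
rewrite /tcov tdiff_rep_ev -/(act w (rep_ev v w)).
have := congr1 (rep_ev v) w_flat.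
rewrite linearD linearZ /= rep_ev_lie // -mulr2n -scaler_nat scalerA.
by rewrite mulVf // scale1r linear0.
Qed.

End Covariant.

(** * Independent one-forms and dimensions *)

Section KernelDimension.
Variables (K : fieldType) (W : cdgaType K) (V : vectType K).
Variables (m : nat) (e : 'I_m -> W).
Hypothesis e_free : forall c : 'I_m -> K, \sum_k c k *: e k = 0 ->
  forall k, c k = 0.

Lemma tens_free (v : 'I_m -> V) : \sum_k e k ⊗ v k = 0 -> forall k, v k = 0.
Proof.
move=> ev0 k; rewrite (coord_vbasis (memvf (v k))) big1 // => i _.
pose f : {linear V -> K^o} := coord (vbasis {:V}) i.
rewrite -/(f (v k)) (e_free (c := fun k => f (v k))) ?scale0r //.
have := congr1 (contract f) ev0; rewrite linear0 linear_sum; apply: etrans.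
by apply: eq_bigr => l _; rewrite /= contract_tpure.
Qed.

(** The elements u chosen over the e_k ⊗ b_i, for b a basis of U1, are linearly
    independent since their images by f are. *)
Lemma dim_lift_le (U1 U2 : {vspace V}) (f : {linear V -> tens W V}) :
  (forall k v, v \in U1 -> exists2 u, u \in U2 & f u = e k ⊗ v) ->
  (m * \dim U1 <= \dim U2)%N.
Proof.
move=> f_lift; pose b := vbasis U1.
have /choice[u u_lift] (p : 'I_m * 'I_(\dim U1)) :
    exists u, u \in U2 /\ f u = e p.1 ⊗ b`_p.2.
  have [|u uU fu] := f_lift p.1 b`_p.2; last by exists u.
  by apply/vbasis_mem/mem_nth; rewrite size_tuple.
have := @dim_ge_card K V _ u U2; rewrite card_prod !card_ord.
apply=> [p|c cu0 [k i]]; first by have [] := u_lift p.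
have cb0 : \sum_k0 e k0 ⊗ (\sum_j c (k0, j) *: b`_j) = 0.
  have := congr1 f cu0; rewrite linear0 linear_sum; apply: etrans.
  under eq_bigr => k0 _ do rewrite linear_sum.
  rewrite pair_big_dep /=; apply: eq_bigr => -[k0 j] _ /=.
  by rewrite !linearZ /= (u_lift (k0, j)).2.
have /freeP b_free := basis_free (vbasisP U1).
exact: (b_free (fun j => c (k, j)) (tens_free cb0 k)).
Qed.

End KernelDimension.

(** * Components of a tensor in a differential ideal *)

Section Ideals.
Variables (K : fieldType) (W : cdgaType K).

Record dg_ideal (P : set W) : Prop := DgIdeal {
  ideal0 : P 0;
  idealP : forall c a b, P a -> P b -> P (c *: a + b);
  idealMl : forall a b, P b -> P (a * b);
  idealMr : forall a b, P a -> P (a * b);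
  ideal_diff : forall a, P a -> P (cdiff a)
}.

Variables (V : vectType K) (g : lieAlgebraType K) (theta : representation g V).

(** For a subspace P of W, this is the subspace P ⊗ V of W ⊗ V.  In terms of contractions, P ∩ Q = 0 readily
    gives that P ⊗ V and Q ⊗ V meet in 0. *)
Definition tens_in (P : set W) (t : tens W V) : Prop := forall f, P (contract f t).

Section OneIdeal.
Variable P : set W.
Hypothesis P_ideal : dg_ideal P.

Lemma idealD a b : P a -> P b -> P (a + b).
Proof. by move=> Pa Pb; rewrite -[a]scale1r; apply: idealP. Qed.

Lemma idealN a : P a -> P (- a).
Proof.
move=> Pa; rewrite -[- a]addr0 -scaleN1r.
by apply: (idealP P_ideal) => //; apply: ideal0.
Qed.

Lemma tens_in0 : tens_in P 0.
Proof. by move=> f; rewrite linear0; apply: ideal0. Qed.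

Lemma tens_inD s t : tens_in P s -> tens_in P t -> tens_in P (s + t).
Proof. by move=> Ps Pt f; rewrite linearD; apply: idealD (Ps f) (Pt f). Qed.

Lemma tens_inN t : tens_in P t -> tens_in P (- t).
Proof. by move=> Pt f; rewrite linearN; apply: idealN (Pt f). Qed.

Lemma tens_in_tpure a v : P a -> tens_in P (a ⊗ v).
Proof.
move=> Pa f; rewrite contract_tpure -[_ *: _]addr0.
by apply: (idealP P_ideal) => //; apply: ideal0.
Qed.

Lemma tens_in_tdiff t : tens_in P t -> tens_in P (tdiff t).
Proof. by move=> Pt f; rewrite contract_tdiff; apply: ideal_diff (Pt f). Qed.

Lemma tens_in_act_r w t : tens_in P t -> tens_in P (act theta w t).
Proof.
move=> Pt; elim/tens_ind: w => [|a x w IH]; first by rewrite act0l; apply: tens_in0.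
rewrite actDl; apply: tens_inD => // f.
by rewrite contract_act_tpure; apply: idealMl (Pt _).
Qed.

Lemma tens_in_act_tpure a x t : P a -> tens_in P (act theta (a ⊗ x) t).
Proof. by move=> Pa f; rewrite contract_act_tpure; apply: idealMr. Qed.

Lemma tens_in_tcov w t : tens_in P t -> tens_in P (tcov theta w t).
Proof. by move=> Pt; apply: tens_inD (tens_in_tdiff Pt) (tens_in_act_r _ Pt). Qed.

End OneIdeal.

Lemma tens_in_disjoint (P Q : set W) : (forall a, P a -> Q a -> a = 0) ->
  forall t, tens_in P t -> tens_in Q t -> t = 0.
Proof. by move=> PQ0 t Pt Qt; apply: contract_eq0 => f; apply: PQ0. Qed.

Lemma tens_in_add_eq (P Q : set W) : dg_ideal P -> dg_ideal Q ->
  (forall a, P a -> Q a -> a = 0) ->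
  forall s s' t t', tens_in P s -> tens_in P s' -> tens_in Q t -> tens_in Q t' ->
  s + t = s' + t' -> s = s' /\ t = t'.
Proof.
move=> P_id Q_id PQ0 s s' t t' Ps Ps' Qt Qt' st.
have dE : s - s' = t' - t.
  by apply/eqP; rewrite subr_eq addrAC eq_sym subr_eq addrC -st addrC.
have d0 : s - s' = 0.
  apply: (tens_in_disjoint PQ0).
    exact: tens_inD P_id _ _ Ps (tens_inN P_id Ps').
  by rewrite dE; apply: tens_inD Q_id _ _ Qt' (tens_inN Q_id Qt).
split; apply/eqP; rewrite -subr_eq0; first by rewrite d0.
by rewrite -opprB -dE d0 oppr0.
Qed.

End Ideals.

(** * Exactness in degree 1 and split connections *)

Section IdealDecomposition.
Variables (K : fieldType) (W : cdgaType K) (g : lieAlgebraType K).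
Variables (V : vectType K) (theta : representation g V).

Lemma thomD (U : lmodType K) i (s t : tens W U) :
  thom i s -> thom i t -> thom i (s + t).
Proof.
case=> s1 h1 -> [s2 h2 ->]; exists (s1 ++ s2); last by rewrite big_cat.
by move=> p; rewrite mem_cat => /orP[/h1|/h2].
Qed.

Lemma thom_tpure (U : lmodType K) i (a : W) (u : U) :
  homog i a -> thom i (a ⊗ u).
Proof.
move=> a_i; exists [:: (a, u)]; last by rewrite big_cons big_nil addr0.
by move=> p; rewrite inE => /eqP ->.
Qed.

Lemma thom_act_unit (w : tens W g) v : thom 1 w -> thom 1 (act theta w (1 ⊗ v)).
Proof.
move: w; apply: thom_ind => [|a x w a1 IH].
  by rewrite act0l; exists [::]; rewrite ?big_nil.
by rewrite actDl act_tpure mulr1; apply: thomD => //; apply: thom_tpure.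
Qed.

Lemma thom_split (P Q : set W) : dg_ideal P -> dg_ideal Q ->
  (forall a, homog 1 a -> exists p q,
     [/\ homog 1 p /\ P p, homog 1 q /\ Q q & a = p + q]) ->
  forall w : tens W g, thom 1 w -> exists wP wQ, [/\ w = wP + wQ, thom 1 wP,
    forall t, tens_in P (act theta wP t) & forall t, tens_in Q (act theta wQ t)].
Proof.
move=> P_id Q_id split1; apply: thom_ind => [|a x w a1].
  exists 0, 0; rewrite addr0; split=> //; first by exists [::]; rewrite ?big_nil.
    by move=> t; rewrite act0l; apply: tens_in0.
  by move=> t; rewrite act0l; apply: tens_in0.
move=> [wP [wQ [-> wP1 wPP wQQ]]].
have [p [q [[p1 Pp] [q1 Qq] ->]]] := split1 a a1.
exists (p ⊗ x + wP), (q ⊗ x + wQ); split.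
- by rewrite tpureDl addrACA.
- by apply: thomD => //; apply: thom_tpure.
- by move=> t; rewrite actDl; apply: tens_inD => //; apply: tens_in_act_tpure.
- by move=> t; rewrite actDl; apply: tens_inD => //; apply: tens_in_act_tpure.
Qed.

Lemma tcov_linear (w : tens W g) : linear (tcov theta w).
Proof.
move=> c s t; rewrite /tcov -!/(act theta w _) !linearP /= scalerDr addrACA.
by [].
Qed.

HB.instance Definition _ w :=
  GRing.isLinear.Build K _ _ *:%R (tcov theta w) (tcov_linear w).

Lemma tcov_unit (w : tens W g) v : tcov theta w (1 ⊗ v) = act theta w (1 ⊗ v).
Proof. by rewrite /tcov tdiff_tpure diff1 tpure0l add0r. Qed.

Hypothesis W_connected : connected_cdga W.

Lemma thom0_unit (t : tens W V) : thom 0 t -> exists v, t = 1 ⊗ v.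
Proof.
move: t; apply: thom_ind => [|a u t]; first by exists 0; rewrite linear0.
rewrite W_connected => -[c _ <-] [v ->]; exists (c *: u + v).
by rewrite tpureZl -tpureZr -linearD.
Qed.

(** One cocycle that is not a coboundary already witnesses positive dimension,
    and connectedness makes every degree 0 element of the form 1 ⊗ v. *)
Lemma nonresonant_exact (w : tens W g) : flat W g w -> ~ resonance W theta 1 1 w ->
  forall z, thom 1 z -> tcov theta w z = 0 -> exists v, z = act theta w (1 ⊗ v).
Proof.
move=> w_flat w_nres z z1 dz; apply: contrapT => z_not.
apply: w_nres; split=> //; exists (fun=> z); split=> // c.
rewrite big_ord1 => -[_ /thom0_unit[v ->]]; rewrite tcov_unit => zE k.
rewrite ord1; apply/eqP/negPn/negP => c0; apply: z_not.
exists ((c ord0)^-1 *: v).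
by rewrite !linearZ /= zE scalerA mulVf // scale1r.
Qed.

End IdealDecomposition.

Section SplitConnection.
Variables (K : fieldType) (W : cdgaType K) (g : lieAlgebraType K).
Variables (V : vectType K) (theta : representation g V).
Variables (P Q : set W) (wP wQ : tens W g).
Hypotheses (P_ideal : dg_ideal P) (Q_ideal : dg_ideal Q).
Hypothesis PQ0 : forall a, P a -> Q a -> a = 0.
Hypothesis wPP : forall t, tens_in P (act theta wP t).
Hypothesis wQQ : forall t, tens_in Q (act theta wQ t).

(** Flatness gives d (wP (1 ⊗ v)) + d (wQ (1 ⊗ v)) = 0 for the covariant
    derivative d; the two terms lie in P ⊗ V and Q ⊗ V, so both vanish. *)
Lemma split_half_closed : 2%:R != 0 :> K -> flat W g (wP + wQ) ->
  forall v, tcov theta (wP + wQ) (act theta wP (1 ⊗ v)) = 0.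
Proof.
move=> two_neq0 w_flat v.
have := tcov_square0 theta two_neq0 v w_flat.
rewrite tcov_unit actDl linearD /= -[RHS]addr0 => dE.
by have [] := tens_in_add_eq P_ideal Q_ideal PQ0
  (tens_in_tcov theta P_ideal _ (wPP _)) (tens_in0 P_ideal)
  (tens_in_tcov theta Q_ideal _ (wQQ _)) (tens_in0 Q_ideal) dE.
Qed.

(** The wP-term vanishes since a can be factored out on the right, and the
    wQ-term since it lies in both P ⊗ V and Q ⊗ V. *)
Lemma split_tpure_closed a v : P a -> cdiff a = 0 -> act theta wP (1 ⊗ v) = 0 ->
  tcov theta (wP + wQ) (a ⊗ v) = 0.
Proof.
move=> Pa da v0.
rewrite /tcov -/(act theta _ _) tdiff_tpure da tpure0l add0r actDl.
have -> : act theta wP (a ⊗ v) = 0.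
  by apply: contract_eq0 => f; rewrite contract_act_unit v0 linear0 mul0r.
rewrite add0r; apply: (tens_in_disjoint PQ0) => //.
by apply: tens_in_act_r => //; apply: tens_in_tpure.
Qed.

(** The primitive 1 ⊗ v of z can be compared with z component by component:
    its Q-component must vanish. *)
Lemma split_half_exact : connected_cdga W -> flat W g (wP + wQ) ->
  ~ resonance W theta 1 1 (wP + wQ) ->
  forall z, thom 1 z -> tens_in P z -> tcov theta (wP + wQ) z = 0 ->
  exists2 v, act theta wP (1 ⊗ v) = z & act theta wQ (1 ⊗ v) = 0.
Proof.
move=> W_conn w_flat w_nres z z1 Pz dz.
have [v] := nonresonant_exact W_conn w_flat w_nres z1 dz.
rewrite actDl -[LHS]addr0 => zE.
have [-> vQ0] :=
  tens_in_add_eq P_ideal Q_ideal PQ0 Pz (wPP _) (tens_in0 Q_ideal) (wQQ _) zE.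
by exists v.
Qed.

End SplitConnection.

(** Stated for a pair of ideals rather than for the two factors of a wedge sum,
    so that both sides live in the same cdga and the lemmas about P and wP
    apply verbatim to Q and wQ.  The cocycles wP (1 ⊗ v) force V = KP + KQ,
    and the cocycles a ⊗ v bound the dimensions of KP and KQ by one another. *)
Theorem resonance_of_disjoint_ideals (K : fieldType) (W : cdgaType K)
    (g : lieAlgebraType K) (V : vectType K) (theta : representation g V)
    (P Q : set W) (m n : nat) (e : 'I_m -> W) (e' : 'I_n -> W) :
  2%:R != 0 :> K -> connected_cdga W -> dg_ideal P -> dg_ideal Q ->
  (forall a, P a -> Q a -> a = 0) ->
  (forall a, homog 1 a -> exists p q,
     [/\ homog 1 p /\ P p, homog 1 q /\ Q q & a = p + q]) ->
  (forall k, [/\ homog 1 (e k), P (e k) & cdiff (e k) = 0]) ->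
  (forall k, [/\ homog 1 (e' k), Q (e' k) & cdiff (e' k) = 0]) ->
  (forall c, \sum_k c k *: e k = 0 -> forall k, c k = 0) ->
  (forall c, \sum_k c k *: e' k = 0 -> forall k, c k = 0) ->
  (1 < m * n)%N -> (0 < \dim {:V})%N ->
  resonance W theta 1 1 = flat W g.
Proof.
move=> two_neq0 W_conn P_id Q_id PQ0 split1 eP eQ e_free e'_free mn_gt1 V_gt0.
apply/seteqP; split=> [w []//|w w_flat]; apply: contrapT => w_nres.
have [wP [wQ [wE wP1 wPP wQQ]]] := thom_split theta P_id Q_id split1 w_flat.1.
rewrite {w}wE in w_flat w_nres.
have [w_flat' w_nres'] : flat W g (wQ + wP) /\
    ~ resonance W theta 1 1 (wQ + wP) by rewrite addrC.
have QP0 a : Q a -> P a -> a = 0 by move=> Qa Pa; apply: PQ0.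
pose alpha : {linear V -> tens W V} := act theta wP \o tpure 1.
pose beta : {linear V -> tens W V} := act theta wQ \o tpure 1.
have exP := split_half_exact P_id Q_id PQ0 wPP wQQ W_conn w_flat w_nres.
have exQ := split_half_exact Q_id P_id QP0 wQQ wPP W_conn w_flat' w_nres'.
have [KP KPE] := linear_kernel alpha.
have [KQ KQE] := linear_kernel beta.
have KPQ : (KP + KQ)%VS = fullv.
  apply/eqP; rewrite eqEsubv subvf; apply/subvP => v _.
  have [] := exP (alpha v).
  - exact: thom_act_unit.
  - exact: wPP.
  - exact: (split_half_closed P_id Q_id PQ0 wPP wQQ two_neq0 w_flat).
  (* v = (v - u) + u, where wP agrees on 1 ⊗ v and 1 ⊗ u, and wQ kills 1 ⊗ u. *)
  move=> u uv /KQE uQ; rewrite -(subrK u v); apply: memv_add => //.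
  by apply/KPE; rewrite linearB /= uv subrr.
have le1 : (m * \dim KP <= \dim KQ)%N.
  apply: (dim_lift_le e_free (f := alpha)) => k v /KPE v0.
  have [e1 Pe de] := eP k.
  have [] := exP (e k ⊗ v).
  - exact: thom_tpure.
  - exact: tens_in_tpure.
  - exact: (split_tpure_closed P_id PQ0 wQQ).
  by move=> u ue /KQE uQ; exists u.
have le2 : (n * \dim KQ <= \dim KP)%N.
  apply: (dim_lift_le e'_free (f := beta)) => k v /KQE v0.
  have [e1 Qe de] := eQ k.
  have [] := exQ (e' k ⊗ v).
  - exact: thom_tpure.
  - exact: tens_in_tpure.
  - exact: (split_tpure_closed Q_id QP0 wPP).
  by move=> u ue /KPE uP; exists u.
have KP0 : \dim KP = 0%N.
  have : (m * n * \dim KP <= \dim KP)%N.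
    by apply: leq_trans le2; rewrite [(m * n)%N]mulnC -mulnA leq_mul2l le1 orbT.
  by rewrite -[leqRHS]mul1n leq_mul2r leqNgt mn_gt1 orbF => /eqP.
have KQ0 : \dim KQ = 0%N.
  move: le2; rewrite KP0 leqn0 muln_eq0 => /orP[/eqP n0|/eqP//].
  by rewrite n0 muln0 in mn_gt1.
have : (\dim {:V} <= \dim KP + \dim KQ)%N by rewrite -KPQ dimv_add_leqif.
by rewrite KP0 KQ0 leqNgt V_gt0.
Qed.

(** * The two ideals of a wedge sum *)

Section WedgeIdeals.
Variables (K : fieldType) (A B : cdgaType K).

Definition left_part : set (wedge A B) := [set w | (wval w).2 = 0].
Definition right_part : set (wedge A B) := [set w | (wval w).1 = 0].

Lemma left_part_ideal : dg_ideal left_part.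
Proof.
rewrite /left_part; split=> //=.
- by move=> c a b -> ->; rewrite scaler0 addr0.
- by move=> a b ->; rewrite mulr0.
- by move=> a b ->; rewrite mul0r.
- by move=> a ->; rewrite linear0.
Qed.

Lemma right_part_ideal : dg_ideal right_part.
Proof.
rewrite /right_part; split=> //=.
- by move=> c a b -> ->; rewrite scaler0 addr0.
- by move=> a b ->; rewrite mulr0.
- by move=> a b ->; rewrite mul0r.
- by move=> a ->; rewrite linear0.
Qed.

Definition wedge_inl i (a : A) (ha : homog i.+1 a) : wedge A B :=
  Wedge (wedge_inl_subproof B (posdeg_homog ha)).
Definition wedge_inr i (b : B) (hb : homog i.+1 b) : wedge A B :=
  Wedge (wedge_inr_subproof A (posdeg_homog hb)).

Lemma wedge_parts_disjoint w : left_part w -> right_part w -> w = 0.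
Proof. by move=> w2 w1; apply: val_inj; rewrite [LHS]surjective_pairing w1 w2. Qed.

Lemma wedge_parts_split w : homog 1 w -> exists p q,
  [/\ homog 1 p /\ left_part p, homog 1 q /\ right_part q & w = p + q].
Proof.
case=> w1 w2; exists (wedge_inl w1), (wedge_inr w2); split.
- by do 2?split=> //; apply: homog0.
- by do 2?split=> //; apply: homog0.
- apply: val_inj; rewrite [LHS]surjective_pairing; congr (_, _) => /=.
    by rewrite addr0.
  by rewrite add0r.
Qed.

(** Classes that are independent modulo coboundaries have independent
    representatives, because 0 is a coboundary. *)
Lemma betti1_left m : betti_ge A 1 m -> exists e : 'I_m -> wedge A B,
  (forall k, [/\ homog 1 (e k), left_part (e k) & cdiff (e k) = 0]) /\
  (forall c, \sum_k c k *: e k = 0 -> forall k, c k = 0).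
Proof.
case=> a [a_cocycle a_free]; exists (fun k => wedge_inl (a_cocycle k).1).
split=> [k|c ca0]; last first.
  apply: a_free; exists 0; first exact: homog0.
  by rewrite linear0 -[LHS]/((\val (0 : wedge A B)).1) -ca0 !raddf_sum.
have [a1 da] := a_cocycle k; split=> //; first by split=> //; apply: homog0.
by apply: val_inj; rewrite /= da linear0.
Qed.

Lemma betti1_right m : betti_ge B 1 m -> exists e : 'I_m -> wedge A B,
  (forall k, [/\ homog 1 (e k), right_part (e k) & cdiff (e k) = 0]) /\
  (forall c, \sum_k c k *: e k = 0 -> forall k, c k = 0).
Proof.
case=> b [b_cocycle b_free]; exists (fun k => wedge_inr (b_cocycle k).1).
split=> [k|c cb0]; last first.
  apply: b_free; exists 0; first exact: homog0.
  by rewrite linear0 -[LHS]/((\val (0 : wedge A B)).2) -cb0 !raddf_sum.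
have [b1 db] := b_cocycle k; split=> //; first by split=> //; apply: homog0.
by apply: val_inj; rewrite /= db linear0.
Qed.

End WedgeIdeals.

Theorem theorem3 (R : realType) (A B : cdgaType R[i])
  (A_connected : connected_cdga A) (B_connected : connected_cdga B)
  (A_finite : finite_type_low A) (B_finite : finite_type_low B)
  (g : lieAlgebraType R[i])
  (b1A_pos : betti_ge A 1 1) (b1B_pos : betti_ge B 1 1)
  (b1_gt1 : betti_ge A 1 2 \/ betti_ge B 1 2)
  (V : vectType R[i]) (V_neq0 : (0 < \dim {:V})%N)
  (theta : representation g V) :
  resonance (wedge A B) theta 1 1 = flat (wedge A B) g.
Proof.
have res_full m n : betti_ge A 1 m -> betti_ge B 1 n -> (1 < m * n)%N ->
    resonance (wedge A B) theta 1 1 = flat (wedge A B) g.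
  move=> /(betti1_left B)[e [eP e_free]] /(betti1_right A)[e' [eQ e'_free]].
  move=> mn_gt1; apply: (resonance_of_disjoint_ideals theta _ _
    (left_part_ideal A B) (right_part_ideal A B) (@wedge_parts_disjoint _ A B)
    (@wedge_parts_split _ A B) eP eQ e_free e'_free mn_gt1 V_neq0).
    by rewrite Num.Theory.pnatr_eq0.
  exact: wedge_connected.
by case: b1_gt1 => [b1A|b1B]; [exact: res_full b1A b1B_pos _|exact: res_full b1A_pos b1B _].
Qed.
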